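(* For integers $p_1,p_2\ge 0$, the edge set of every digraph $D\in D(p_1+p_2,p_1+p_2)$ can be partitioned into the edge sets of two subgraphs $D_1\in D(p_1,p_1)$ and $D_2\in D(p_2,p_2)$.
   Context: All digraphs are finite, without loops and without parallel edges. For integers $k,\ell\ge 0$, $D(k,\ell)$ denotes the family of digraphs in which every vertex $v$ satisfies $d^-(v)\le k$ or $d^+(v)\le \ell$ (indegree at most $k$ or outdegree at most $\ell$). Subgraphs are taken on the same vertex set, determined by their edge sets. *)

(* Defs.v *)
From mathcomp Require Import all_boot.

Set Implicit Arguments.
Unset Strict Implicit.
Unset Printing Implicit Defensive.

(* (u, v) is the edge from u to v. As edges form a set of ordered pairs, there
   are no parallel edges; the opposite edges (u, v) and (v, u) may coexist. *)
Record digraph (V : finType) := Digraph {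
  edges : {set V * V};
  edges_loopless : forall v : V, (v, v) \notin edges
}.

Definition indeg (V : finType) (D : digraph V) (v : V) : nat :=
  #|[set u | (u, v) \in edges D]|.

Definition outdeg (V : finType) (D : digraph V) (v : V) : nat :=
  #|[set w | (v, w) \in edges D]|.

Definition in_Dkl (k l : nat) (V : finType) (D : digraph V) : Prop :=
  forall v : V, indeg D v <= k \/ outdeg D v <= l.

(* Either part may be empty, so this is not finset's [partition], which
   excludes the empty set as a block. *)
Definition edge_partition (V : finType) (D D1 D2 : digraph V) : Prop :=
  edges D1 :|: edges D2 = edges D /\ [disjoint edges D1 & edges D2].

(* Main.v *)
(** Call a vertex bad if its indegree exceeds [p1 + p2], so that its outdegree
    is at most [p1 + p2]. A bad vertex only constrains the edges leaving it, a
    good one only those entering it. Cut every edge loose from its tail unless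
    the tail is bad, and from its head unless the head is good: the outcome is
    a bipartite graph (bad tails against good heads, plus pendant ends) of
    maximum degree at most [p1 + p2]. König's theorem colours its edges
    properly with [p1 + p2] colours; [D1] takes [p1] of them, [D2] the rest. *)
Require Import Defs.
From mathcomp Require Import all_boot.

Set Implicit Arguments.
Unset Strict Implicit.
Unset Printing Implicit Defensive.

(* An edge [e] joins [f e] to [g e] in a bipartite multigraph with sides [X]
   and [Y]. *)
Definition proper_colouring (E : finType) (X Y C : eqType) (f : E -> X)
    (g : E -> Y) (S : {set E}) (c : E -> C) : Prop :=
  {in S &, forall e e', f e = f e' \/ g e = g e' -> c e = c e' -> e = e'}.

(** * Kempe chains in edge-coloured bipartite multigraphs *)

Section Kempe.
Variables (E : finType) (X Y C : eqType) (f : E -> X) (g : E -> Y).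
Variables (S : {set E}) (c : E -> C) (x : X) (a b : C).
Hypothesis c_proper : proper_colouring f g S c.
Hypothesis a_free : {in S, forall e, f e = x -> c e != a}.

(** Steps are directed by side: a [b]-edge is left through its end in [Y], an [a]-edge through its
    end in [X]. Along a walk that starts with a [b]-edge at [x], every [a]-edge is thus entered at
    [Y] and every [b]-edge at [X]. *)
Definition kempe_step : rel E := fun e e' =>
  (e' \in S) && ([&& c e == b, c e' == a & g e == g e'] ||
                 [&& c e == a, c e' == b & f e == f e']).

Definition kempe_seed (e : E) : bool := [&& e \in S, f e == x & c e == b].

Definition kempe : {set E} :=
  [set e | [exists e0, kempe_seed e0 && connect kempe_step e0 e]].

Definition kempe_swap (e : E) : C :=
  if e \in kempe then (if c e == a then b else a) else c e.

Lemma kempe_seedP e : kempe_seed e -> e \in kempe.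
Proof. by move=> se; rewrite inE; apply/existsP; exists e; rewrite se connect0. Qed.

Lemma kempe_stepP e e' : e \in kempe -> kempe_step e e' -> e' \in kempe.
Proof.
rewrite !inE => /existsP[e0 /andP[se0 e0e]] ee'; apply/existsP; exists e0.
by rewrite se0 (connect_trans e0e) ?connect1.
Qed.

Lemma kempe_pred e : e \in kempe ->
  kempe_seed e \/ exists2 e', e' \in kempe & kempe_step e' e.
Proof.
rewrite inE => /existsP[e0 /andP[se0 /connectP[q]]].
case/lastP: q => [_ -> | q z]; first by left.
rewrite rcons_path last_rcons => /andP[qP zP] ->; right.
exists (last e0 q) => //; rewrite inE; apply/existsP; exists e0.
by rewrite se0; apply/connectP; exists q.
Qed.

Hypothesis neq_ab : a != b.

Lemma kempe_sub e : e \in kempe -> e \in S.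
Proof. by case/kempe_pred=> [/and3P[]|[e' _ /andP[]]]. Qed.

Lemma kempe_colour e : e \in kempe -> c e = a \/ c e = b.
Proof.
case/kempe_pred=> [/and3P[_ _ /eqP]|[e' _ /andP[_]]]; first by right.
by case/orP=> /and3P[_ /eqP-> _]; [left | right].
Qed.

Lemma kempe_pred_a e : e \in kempe -> c e = a ->
  exists2 e', e' \in kempe & c e' = b /\ g e' = g e.
Proof.
move=> eK ea; case/kempe_pred: eK => [/and3P[_ _]|[e' e'K /andP[_]]].
  by rewrite ea (negPf neq_ab).
case/orP=> /and3P[/eqP e'c + /eqP e'e]; first by exists e'.
by rewrite ea (negPf neq_ab).
Qed.

Lemma kempe_pred_b e : e \in kempe -> c e = b ->
  f e = x \/ exists2 e', e' \in kempe & c e' = a /\ f e' = f e.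
Proof.
move=> eK eb; case/kempe_pred: eK => [/and3P[_ /eqP]|[e' e'K /andP[_]]].
  by left.
case/orP=> /and3P[/eqP e'c + /eqP e'e]; last by right; exists e'.
by rewrite eb eq_sym (negPf neq_ab).
Qed.

(** By properness [e] and [e'] carry different colours. If they meet where the chain leaves [e],
    then [e'] is a next step. If they meet where it enters [e], then [e'] is the predecessor of [e]
    by properness; a seed has none, but at its end [x] the colour [a] is free. *)
Lemma kempe_closed e e' : e \in kempe -> e' \in S -> c e' = a \/ c e' = b ->
  f e = f e' \/ g e = g e' -> e' \in kempe.
Proof.
move=> eK e'S e'c ee'; have eS := kempe_sub eK.
have [<-//|neq] := eqVneq e e'.
have neqc : c e != c e'.
  by apply: contra_neq neq => /(c_proper eS e'S ee').
case: (kempe_colour eK) e'c neqc => ec [] e'c; rewrite ec e'c ?eqxx // => _.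
- case: ee' => ee'.
    by apply: (kempe_stepP eK); rewrite /kempe_step e'S ec e'c ee' !eqxx orbT.
  have [z zK [zb zg]] := kempe_pred_a eK ec.
  suff <- : z = e' by [].
  by apply: c_proper (kempe_sub zK) e'S _ _; [right; rewrite zg | rewrite zb].
- case: ee' => ee'; last first.
    by apply: (kempe_stepP eK); rewrite /kempe_step e'S ec e'c ee' !eqxx.
  case: (kempe_pred_b eK ec) => [ex|[z zK [za zf]]].
    by case/eqP: (a_free e'S (etrans (esym ee') ex)).
  suff <- : z = e' by [].
  by apply: c_proper (kempe_sub zK) e'S _ _; [left; rewrite zf | rewrite za].
Qed.

(** Within the chain, exchanging [a] and [b] is injective; a conflict between the chain and its
    outside would be a neighbour coloured [a] or [b], against [kempe_closed]. *)
Lemma kempe_swap_proper : proper_colouring f g S kempe_swap.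
Proof.
have inv e : e \in kempe -> kempe_swap e = a \/ kempe_swap e = b.
  by rewrite /kempe_swap => ->; case: ifP; [right | left].
move=> e e' eS e'S ee'.
have e'e : f e' = f e \/ g e' = g e by case: ee' => ->; [left | right].
have [eK|eK] := boolP (e \in kempe); have [e'K|e'K] := boolP (e' \in kempe).
- rewrite /kempe_swap eK e'K => sw; apply: c_proper => //; move: sw.
  case: (kempe_colour eK) (kempe_colour e'K) => -> [] ->;
    by rewrite ?eqxx // (eq_sym b) (negPf neq_ab) // => /eqP;
       rewrite ?(eq_sym b) (negPf neq_ab).
- move=> sw; case/negP: (e'K); apply: (kempe_closed eK) => //.
  by move: (inv e eK); rewrite sw /kempe_swap (negPf e'K).
- move=> sw; case/negP: (eK); apply: (kempe_closed e'K) => //.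
  by move: (inv e' e'K); rewrite -sw /kempe_swap (negPf eK).
- by rewrite /kempe_swap (negPf eK) (negPf e'K); apply: c_proper.
Qed.

(** Any [b]-edge at [x] is a seed, hence recoloured, and no [a]-edge is there to turn into [b]. *)
Lemma kempe_swap_free_left : {in S, forall e, f e = x -> kempe_swap e != b}.
Proof.
move=> e eS ex; rewrite /kempe_swap (negPf (a_free eS ex)).
case: ifPn => // eK; apply: contra eK => eb.
by apply: kempe_seedP; rewrite /kempe_seed eS ex eqxx.
Qed.

(* A swapped [a]-edge at [y] would have been entered through a [b]-edge at
   [y]: this is where bipartiteness is used. *)
Lemma kempe_swap_free_right y : {in S, forall e, g e = y -> c e != b} ->
  {in S, forall e, g e = y -> kempe_swap e != b}.
Proof.
move=> b_free e eS ey; rewrite /kempe_swap.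
case: ifPn => [eK|_]; last exact: b_free.
case: ifPn => // /eqP ea; have [z zK [zb zg]] := kempe_pred_a eK ea.
by have := b_free z (kempe_sub zK) (etrans zg ey); rewrite zb eqxx.
Qed.

End Kempe.

(** * König's edge colouring theorem *)

(** Since [e] itself takes up one unit of the degree, the other edges at its end use fewer than
    [#|C|] colours. *)
Lemma free_colour (E C : finType) (X : eqType) (f : E -> X) (S : {set E})
    (c : E -> C) (e : E) : e \in S -> #|[set e' in S | f e' == f e]| <= #|C| ->
  exists a, {in S :\ e, forall e', f e' = f e -> c e' != a}.
Proof.
move=> eS degS; pose T := [set e' in S :\ e | f e' == f e].
have ltT : #|c @: T| < #|C|.
  apply: leq_trans degS; apply: (leq_ltn_trans (leq_imset_card _ _)).
  apply/proper_card/properP; split; last by exists e; rewrite !inE ?eS !eqxx.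
  by apply/subsetP=> z; rewrite !inE => /andP[/andP[_ ->]].
have : ~: (c @: T) != set0.
  by rewrite -card_gt0 -subn_gt0 in ltT *; rewrite cardsCs setCK.
case/set0Pn=> a; rewrite inE => aT; exists a => e' e'S e'f.
apply: contraNneq aT => <-; apply: imset_f.
by move: e'S; rewrite !inE e'f eqxx andbT.
Qed.

(** Induction on the number of edges: colour all but one edge [e], then make a single colour free at
    both ends of [e]. *)
Lemma konig_edge_colouring (E C : finType) (X Y : eqType) (f : E -> X)
    (g : E -> Y) (S : {set E}) (c0 : C) :
  {in S, forall e, #|[set e' in S | f e' == f e]| <= #|C|} ->
  {in S, forall e, #|[set e' in S | g e' == g e]| <= #|C|} ->
  exists c : E -> C, proper_colouring f g S c.
Proof.
have [n] := ubnP #|S|; elim: n S => // n IHn S leSn degf degg.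
have [->|[e eS]] := set_0Vmem S; first by exists (fun=> c0) => e; rewrite inE.
have deg_sub (Z : eqType) (h : E -> Z) :
    {in S, forall z, #|[set e' in S | h e' == h z]| <= #|C|} ->
    {in S :\ e, forall z, #|[set e' in S :\ e | h e' == h z]| <= #|C|}.
  move=> degh z /setD1P[_ zS]; apply: leq_trans (degh z zS).
  apply/subset_leq_card/subsetP=> w; rewrite !inE.
  by case/andP=> /andP[_ ->].
have [||| c cP] := IHn (S :\ e).
- by rewrite (cardsD1 e S) eS in leSn.
- exact: deg_sub.
- exact: deg_sub.
have [a aP] := free_colour c eS (degf e eS).
have [b bP] := free_colour c eS (degg e eS).
(* [a] is free at [f e] and [b] at [g e]. If they differ, swapping the chain from [f e] frees [b]
   there and keeps it free at [g e]. *)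
have [c' [c'P c'f c'g]] : exists c' : E -> C,
    [/\ proper_colouring f g (S :\ e) c',
        {in S :\ e, forall z, f z = f e -> c' z != b}
      & {in S :\ e, forall z, g z = g e -> c' z != b}].
  have [eab|neq_ab] := eqVneq a b; first by subst b; exists c.
  exists (kempe_swap f g (S :\ e) c (f e) a b); split.
  - exact: kempe_swap_proper.
  - exact: kempe_swap_free_left.
  - exact: kempe_swap_free_right.
exists (fun z => if z == e then b else c' z) => z w zS wS.
have [->|ze] := eqVneq z e; have [->//|we] := eqVneq w e.
- have wS' : w \in S :\ e by rewrite !inE we.
  by case=> /esym ew /esym/eqP; [have := c'f w wS' ew | have := c'g w wS' ew];
     move/negPf->.
- have zS' : z \in S :\ e by rewrite !inE ze.
  by case=> ze' /eqP; [have := c'f z zS' ze' | have := c'g z zS' ze'];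
     move/negPf->.
- by apply: c'P; rewrite !inE ?ze ?we.
Qed.

(** * From edge colourings to partitions of digraphs *)

Definition sub_digraph (V : finType) (D : digraph V) (P : pred (V * V)) :
  digraph V.
Proof.
exists [set e in edges D | P e] => v.
by rewrite inE (negPf (edges_loopless D v)).
Defined.

Lemma edges_sub_digraph (V : finType) (D : digraph V) (P : pred (V * V)) e :
  (e \in edges (sub_digraph D P)) = (e \in edges D) && P e.
Proof. by rewrite inE. Qed.

Lemma edge_partition_sub_digraph (V : finType) (D : digraph V)
    (P : pred (V * V)) :
  edge_partition D (sub_digraph D P) (sub_digraph D (predC P)).
Proof.
split; first by apply/setP=> e; rewrite in_setU !edges_sub_digraph -andb_orr orbN andbT.
rewrite disjoint_subset; apply/subsetP=> e.
by rewrite [_ \in edges _]edges_sub_digraph !inE => /andP[-> ->].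
Qed.

(** At each vertex the colouring is injective on the constrained side (out-edges if [B] holds,
    in-edges otherwise), so at most [#|Q|] edges there have a colour in [Q]. *)
Lemma in_Dkl_sub_digraph (V : finType) (D : digraph V) (C : finType)
    (c : V * V -> C) (B : pred V) (Q : pred C) :
  (forall u v w, ~~ B v -> (u, v) \in edges D -> (w, v) \in edges D ->
     c (u, v) = c (w, v) -> u = w) ->
  (forall u v w, B v -> (v, u) \in edges D -> (v, w) \in edges D ->
     c (v, u) = c (v, w) -> u = w) ->
  in_Dkl #|Q| #|Q| (sub_digraph D (fun e => Q (c e))).
Proof.
have inj_card (T : {set V}) (h : V -> C) :
    {in T &, injective h} -> {in T, forall u, Q (h u)} -> #|T| <= #|Q|.
  move=> /card_in_imset<- hQ; apply/subset_leq_card/subsetP=> _ /imsetP[u uT ->].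
  exact: hQ.
move=> cin cout v; have [vB|vB] := boolP (B v); [right | left].
  apply: (inj_card _ (fun w => c (v, w))) => [u w|u]; rewrite !inE.
    by move=> /andP[uD _] /andP[wD _]; apply: cout.
  by case/andP.
apply: (inj_card _ (fun w => c (w, v))) => [u w|u]; rewrite !inE.
  by move=> /andP[uD _] /andP[wD _]; apply: cin.
by case/andP.
Qed.

Theorem theorem8 (p1 p2 : nat) (V : finType) (D : digraph V)
    (hD : in_Dkl (p1 + p2) (p1 + p2) D) :
  exists D1 D2 : digraph V,
    [/\ edge_partition D D1 D2, in_Dkl p1 p1 D1 & in_Dkl p2 p2 D2].
Proof.
pose C := ('I_p1 + 'I_p2)%type.
have cardC : #|{: C}| = p1 + p2 by rewrite card_sum !card_ord.
(* With no colours, [p1] and [p2] are both 0 and every subgraph of [D] stays in the family, so [D1]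
   may take all edges. *)
have [p0|/card_gt0P[c0 _]] := posnP #|{: C}|.
  have D0 P : in_Dkl 0 0 (sub_digraph D P).
    move=> v; have := hD v; rewrite -cardC p0.
    case=> le0; [left | right]; apply: leq_trans le0;
      apply/subset_leq_card/subsetP=> u; rewrite !inE; by case/andP.
  move/eqP: p0; rewrite cardC addn_eq0 => /andP[/eqP-> /eqP->].
  exists (sub_digraph D predT), (sub_digraph D (predC predT)).
  by split=> //; apply: edge_partition_sub_digraph.
pose B v := p1 + p2 < indeg D v.
(* [inl] retains a real vertex as the end of the edge; [inr e] is a pendant end private to [e], of
   degree 1. *)
pose f (e : V * V) : V + V * V := if B e.1 then inl e.1 else inr e.
pose g (e : V * V) : V + V * V := if B e.2 then inr e else inl e.2.
have card1 (e : V * V) : #|[set e' in edges D | e' == e]| <= #|{: C}|.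
  apply: (@leq_trans 1); last by apply/card_gt0P; exists c0.
  rewrite -(cards1 e); apply/subset_leq_card/subsetP=> z.
  by rewrite !inE => /andP[].
have degf :
    {in edges D, forall e, #|[set e' in edges D | f e' == f e]| <= #|{: C}|}.
  case=> u v _; rewrite {2}/f /=; case: ifPn => uB.
    have : outdeg D u <= #|{: C}|.
      by rewrite cardC; case: (hD u) => //; rewrite leqNgt -/(B u) uB.
    have inj_u : injective (pair u : V -> V * V) by move=> w w' [].
    apply: leq_trans; rewrite /outdeg -(card_imset _ inj_u).
    apply/subset_leq_card/subsetP=> -[u' w]; rewrite !inE /f /=.
    case: ifP => _ /andP[uwD] // /eqP[uu']; rewrite uu' in uwD *.
    by apply: imset_f; rewrite inE.
  apply: leq_trans (card1 (u, v)); apply/subset_leq_card/subsetP=> z.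
  by rewrite !inE /f; case: ifP => _ /andP[->].
have degg :
    {in edges D, forall e, #|[set e' in edges D | g e' == g e]| <= #|{: C}|}.
  case=> u v _; rewrite {2}/g /=; case: ifPn => vB.
    apply: leq_trans (card1 (u, v)); apply/subset_leq_card/subsetP=> z.
    by rewrite !inE /g; case: ifP => _ /andP[->].
  have : indeg D v <= #|{: C}| by rewrite cardC leqNgt.
  have inj_v : injective (pair^~ v : V -> V * V) by move=> w w' [].
  apply: leq_trans; rewrite /indeg -(card_imset _ inj_v).
  apply/subset_leq_card/subsetP=> -[w v']; rewrite !inE /g /=.
  case: ifP => _ /andP[wvD] // /eqP[vv']; rewrite vv' in wvD *.
  by apply/imsetP; exists w; rewrite ?inE.
have [c cP] := konig_edge_colouring c0 degf degg.
(* The left summand of [C] supplies the [p1] colours of [D1]. *)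
pose Q (i : C) := if i is inl _ then true else false.
have cardQ : #|Q| = p1.
  have inl_inj : injective (inl : 'I_p1 -> C) by move=> i j [].
  apply: etrans (card_ord p1); rewrite -(card_codom inl_inj).
  apply: eq_card => -[i|i].
    by rewrite codom_f.
  by apply/esym/negbTE/codomP=> -[].
have cardQC : #|predC Q| = p2.
  by apply: (@addnI p1); rewrite -cardC -(fintype.cardC Q) cardQ.
exists (sub_digraph D (fun e => Q (c e))), (sub_digraph D (predC (fun e => Q (c e)))).
(* Edges entering a good vertex share their [g]-end, and below those leaving a bad one share their
   [f]-end, so properness separates them. *)
have cin u v w : ~~ B v -> (u, v) \in edges D -> (w, v) \in edges D ->
    c (u, v) = c (w, v) -> u = w.
  move=> vB uD wD cc; suff [] : (u, v) = (w, v) by [].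
  by apply: cP uD wD _ cc; right; rewrite /g /= (negPf vB).
have cout u v w : B v -> (v, u) \in edges D -> (v, w) \in edges D ->
    c (v, u) = c (v, w) -> u = w.
  move=> vB uD wD cc; suff [] : (v, u) = (v, w) by [].
  by apply: cP uD wD _ cc; left; rewrite /f /= vB.
split; first exact: edge_partition_sub_digraph.
  by rewrite -{1 2}cardQ; exact: in_Dkl_sub_digraph Q cin cout.
by rewrite -{1 2}cardQC; exact: in_Dkl_sub_digraph (predC Q) cin cout.
Qed.
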